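(* Let $G$ be a finite group. Suppose that every maximal subgroup $M$ of $G$ either is nilpotent or has index $|G:M|$ equal to a prime number or to the square of a prime number. Then $G$ is solvable.
   Context: All groups are finite. A maximal subgroup of $G$ is a proper subgroup of $G$ that is not properly contained in any other proper subgroup of $G$. *)

(* Defs.v *)
From mathcomp Require Import all_boot fingroup gseries nilpotent.

Set Implicit Arguments.
Unset Strict Implicit.
Unset Printing Implicit Defensive.

(* Main.v *)
(** In a minimal counterexample G there is a unique minimal normal subgroup N,
    which is perfect.  Let p be the largest prime divisor of |N|, so p > 3 by
    Burnside's p^a q^b theorem, and let T be a Sylow p-subgroup of N.  Counting
    Sylow subgroups modulo p shows that the maximal subgroup containing N_G(T)
    is nilpotent.  By transfer T is not abelian, and this forces a
    non-nilpotent maximal subgroup not containing N to have index exactly p^2.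

    If there is no such subgroup, then either G <> N, all maximal subgroups not
    containing N are conjugate nilpotent Hall subgroups, and one of them
    contains a Sylow subgroup of G for every prime; or G = N, distinct maximal
    subgroups meet trivially, and transfer contradicts perfection.

    If L is such a subgroup, then N_G(T) is a Sylow p-subgroup P of G acting
    faithfully and transitively on the p^2 cosets of L.  Hence P has an abelian
    maximal subgroup A, a center of order p, and centralizers of order p^2 for
    the elements outside A.  An SL_2(p)-type computation then shows that P
    controls the fusion of these elements, and transfer into T / (T :&: A)
    contradicts the perfection of N. *)

Require Import Defs.
From mathcomp Require Import all_boot fingroup gseries nilpotent.
From mathcomp Require Import ssralg morphism quotient gproduct gfunctor.
From mathcomp Require Import commutator center pgroup sylow cyclic maximal.
From mathcomp Require Import finmodule integral_char.

Set Implicit Arguments.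
Unset Strict Implicit.
Unset Printing Implicit Defensive.

Import FiniteModule.

Local Open Scope group_scope.

(** * Transfer and fusion *)

(* B contains the focal subgroup of T in H.  The transfer H -> T / B is
   trivial, and it maps t in T to the coset of t ^+ #|H : T|. *)
Lemma perfect_focal_sub (gT : finGroupType) (p : nat) (H T B : {group gT}) :
    H^`(1) = H -> p.-Sylow(H) T -> B <| T -> T^`(1) \subset B ->
    (forall t g, t \in T -> g \in H -> t ^ g \in T -> [~ t, g] \in B) ->
  T \subset B.
Proof.
move=> perfH sylT nsBT sT'B focB; have [sTH pT _] := and3P sylT.
have nBT := normal_norm nsBT.
pose alpha := restrm_morphism nBT (coset_morphism B).
have def_alpha : alpha @* T = T / B by rewrite morphim_restrm setIid.
have abelA : abelian (alpha @* T) by rewrite def_alpha sub_der1_abelian.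
have tr0 g : g \in H -> transfer H abelA g = 0%R.
  move=> Hg; suffices sHker : H \subset 'ker (transfer H abelA).
    exact: mker (subsetP sHker g Hg).
  rewrite -{1}perfH gen_subG; apply/subsetP=> _ /imset2P[x y Hx Hy ->].
  by rewrite !inE groupR //= morphR //; apply/commgP; apply: GRing.addrC.
apply/subsetP=> t Tt; have Ht := subsetP sTH t Tt.
have trX := transversalP (rcosets_cycle_partition sTH Ht).
set X := transversal _ _ in trX; have /and3P[_ sXH _] := trX.
(* Each term of the cycle expansion is a conjugate, lying in [T], of a power of [t]; modulo [B] it
   equals that power, and the exponents sum to [#|H : T|]. *)
have at0: (fmod abelA (alpha t) *+ #|H : T| = 0)%R.
  rewrite -(tr0 t Ht) (transfer_cycle_expansion sTH abelA Ht trX).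
  rewrite -(sum_index_rcosets_cycle sTH Ht trX) -GRing.sumrMnr /restrm.
  apply: eq_bigr => x Xx; rewrite -[(_ *+ _)%R]morphX ?mem_morphim //=.
  rewrite -morphX //= /restrm; congr fmod.
  have Ttx: (t ^+ #|<[t]> : T :* x|) ^ x^-1 \in T.
    by rewrite conjgE invgK mulgA -mem_rcoset mulg_exp_card_rcosets.
  apply/rcoset_kercosetP; rewrite ?(subsetP nBT) ?groupX //=.
  rewrite mem_rcoset -{1}[t ^+ _]invgK -conjVg -commgEl.
  by apply: focB; rewrite ?groupV ?groupX ?(subsetP sXH) // conjVg groupV.
have/= := congr_fmod at0; rewrite fmval0 morphX ?inE //= fmodK ?mem_morphim //.
(* The index [#|H : T|] is prime to [#|T / B|], so taking that power can be undone in the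
   quotient. *)
rewrite /restrm /= => /(congr1 (expgn^~ (expg_invn (T / B) #|H : T|))).
rewrite expg1n expgK ?mem_quotient ?coprime_morphl //; last first.
  by case/pHall_Hall/andP: sylT.
by move=> t1; rewrite coset_idr ?(subsetP nBT).
Qed.

(** The group [E <*> <[u]>] is a p-group, hence nilpotent: its centre meets [E] nontrivially, and
    commutation with [<[u]>] strictly shrinks nontrivial subgroups. As proper subgroups of [E] have
    order 1 or [p], one commutation step lands in the fixed points. *)
Lemma card_p2_pelt_action (gT : finGroupType) (p : nat) (E : {group gT})
    (u : gT) :
    prime p -> #|E| = (p ^ 2)%N -> p.-elt u -> u \in 'N(E) -> u \notin 'C(E) ->
  #|'C_E[u]| = p /\ [~: E, <[u]>] \subset 'C_E[u].
Proof.
move=> p_pr oE pu nEu notcEu.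
have pE: p.-group E by rewrite /pgroup oE pnatX pnat_id.
have sCE : 'C_E[u] \subset E by apply: subsetIl.
have nEU : <[u]> \subset 'N(E) by rewrite cycle_subG.
have pEU: p.-group (E <*> <[u]>) by rewrite norm_joinEr // pgroupM pE.
have ntE : E :!=: 1.
  by rewrite trivg_card1 oE -(exp1n 2) eqn_exp2r // neq_ltn prime_gt1 ?orbT.
have nilEU := pgroup_nil pEU.
have sRE : [~: E, <[u]>] \proper E.
  by apply: (nil_comm_properl nilEU); rewrite ?joing_subl // subsetI joing_subr.
have prop_p (D : {group gT}) : D \proper E -> #|D| %| p.
  move=> ltDE; have /(dvdn_pfactor _ _ p_pr)[k _ oD] : #|D| %| p ^ 2.
    by rewrite -oE cardSg ?proper_sub.
  have := proper_card ltDE; rewrite oD oE ltn_exp2l ?prime_gt1 // => lt_k2.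
  by rewrite -{2}(expn1 p) dvdn_exp2l.
have ltCE : 'C_E[u] \proper E.
  rewrite properE sCE; apply: contra notcEu => /subsetIP[_ sEC].
  by apply/centP=> x Ex; apply/cent1P; rewrite cent1C (subsetP sEC).
split.
  have [] := primeP p_pr => _ /(_ _ (prop_p [group of 'C_E[u]] ltCE)).
  case/orP=> [|/eqP//]; rewrite -trivg_card1 => /eqP C1.
  have sEZ : E :&: 'Z(E <*> <[u]>) \subset 'C_E[u].
    rewrite setIS // subIset // -cent_cycle centS ?orbT // joing_subr //.
  have nsE : E <| E <*> <[u]> by rewrite normalYl.
  have E1: E :=: 1.
    by apply: TI_center_nil nilEU nsE _; apply/trivgP; rewrite -C1.
  by rewrite E1 eqxx in ntE.
rewrite subsetI (proper_sub sRE) /= -cent_cycle.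
have [-> | ntR] := eqVneq [~: E, <[u]>] 1; first exact: sub1G.
apply/commG1P; apply/eqP; rewrite trivg_card1 -dvdn1.
have ltRR : [~: [~: E, <[u]>], <[u]>] \proper [~: E, <[u]>].
  apply: (nil_comm_properl nilEU) => //.
    by rewrite (subset_trans (proper_sub sRE)) ?joing_subl.
  by rewrite subsetI joing_subr commg_normr.
have oR : #|[~: E, <[u]>]| %| p by apply: prop_p.
have := proper_card ltRR.
have : #|[~: [~: E, <[u]>], <[u]>]| %| p.
  by rewrite (dvdn_trans _ oR) // cardSg ?proper_sub.
have [] := primeP p_pr => _ dp /dp/orP[/eqP->//| /eqP ->].
by rewrite ltnNge (dvdn_leq (prime_gt0 p_pr) oR).
Qed.

(* If u is not in P, it fixes a subgroup <[y]> of E other than <[z]> = 'Z(P).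
   An element v of 'N_P(E) \ E and a power of u then act on E as opposite
   transvections for the basis (y, z), and w = v * u ^+ k * v acts as the Weyl
   element of SL_2(p), so w * w inverts 'Z(P), which is centralized by P. *)
Lemma pelt_norm_selfcent_p2 (gT : finGroupType) (p : nat) (G P E : {group gT})
    (u : gT) :
    prime p -> odd p -> p.-group P -> P \subset G -> #|'Z(P)| = p ->
    'N_G('Z(P)) \subset P -> E \proper P -> 'C_P(E) = E -> #|E| = (p ^ 2)%N ->
  u \in G -> p.-elt u -> u \in 'N(E) -> u \in P.
Proof.
move=> p_pr odd_p pP sPG oZ sNZ ltEP cEE oE Gu pu nEu.
apply/idPn=> notPu; have [sEP _] := andP ltEP.
have sZE : 'Z(P) \subset E by rewrite -cEE setIS // centS.
have sCZP g : g \in G -> g \in 'C('Z(P)) -> g \in P.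
  by move=> Gg cZg; rewrite (subsetP sNZ) // inE Gg (subsetP (cent_sub _)).
have notcEu : u \notin 'C(E).
  by apply: contra notPu => cEu; rewrite sCZP // (subsetP (centS sZE)).
have [v] : exists v, v \in 'N_P(E) :\: E.
  have := nilpotent_proper_norm (pgroup_nil pP) ltEP.
  by case/properP=> _ [v Nv notEv]; exists v; rewrite inE notEv.
case/setDP=> /setIP[Pv nEv] notEv.
have Gv := subsetP sPG v Pv; have pv := mem_p_elt pP Pv.
have notcEv : v \notin 'C(E).
  by apply: contra notEv => cEv; rewrite -cEE inE Pv.
have [oCv sRv] := card_p2_pelt_action p_pr oE pv nEv notcEv.
have [oCu sRu] := card_p2_pelt_action p_pr oE pu nEu notcEu.
have cEab : abelian E by apply: card_p2group_abelian oE.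
have defZ : 'Z(P) = 'C_E[v].
  apply/eqP; rewrite eqEcard oZ oCv leqnn andbT subsetI sZE.
  by rewrite sub_cent1 (subsetP _ v Pv) // centsC subsetIr.
have gen (D : {group gT}) d : #|D| = p -> d \in D -> d != 1 -> D :=: <[d]>.
  move=> oD Dd ntd; apply/eqP; rewrite eq_sym eqEcard cycle_subG Dd oD /=.
  have: #[d] %| p by rewrite -oD order_dvdG.
  have [] := primeP p_pr => _ dp /dp/orP[|/eqP<-//].
  by rewrite order_eq1 (negPf ntd).
(* If all fixed points of [u] in [E] were central in [P], they would form ['Z(P)], and [u] would
   normalize it and lie in [P]. *)
have [y Yy notZy] : exists2 y, y \in 'C_E[u] & y \notin 'Z(P).
  apply/subsetPn; apply: contra notPu => sYZ; rewrite (subsetP sNZ) // inE Gu.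
  have <- : 'C_E[u] = 'Z(P) by apply/eqP; rewrite eqEcard sYZ oCu oZ leqnn.
  by rewrite (subsetP (cent_sub _)) // -sub_cent1 subsetIr.
have [Ey cuy] := setIP Yy.
pose z := [~ y, v].
have Zz : z \in 'Z(P) by rewrite defZ (subsetP sRv) // mem_commg ?cycle_id.
have ntz : z != 1.
  by apply: contra notZy => /commgP cyv; rewrite defZ inE Ey; apply/cent1P.
have genZ := gen _ z oZ Zz ntz.
have Ez := subsetP sZE z Zz.
pose x := [~ z, u].
have Yx : x \in 'C_E[u] by rewrite (subsetP sRu) // mem_commg ?cycle_id.
have ntx : x != 1.
  apply: contra notPu => /commgP czu; rewrite sCZP // genZ cent_cycle.
  exact/cent1P.
(* The nontrivial element [x] generates ['C_E[u]], of order [p]; [k] is chosen so that [u ^+ k]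
   sends [z] to [z * y^-1]. *)
have /cycleP[k Dk] : y^-1 \in <[x]> by rewrite -(gen _ x oCu) // groupV.
have zuk : z ^ (u ^+ k) = z * y^-1.
  rewrite conjg_mulR Dk commgX //; apply/cent1P.
  by rewrite cent1C; case/setIP: Yx.
have yuk : y ^ (u ^+ k) = y.
  by apply/conjg_fixP/commgP; apply: commuteX; apply/cent1P.
have yv : y ^ v = y * z by rewrite conjg_mulR.
have cvz : z ^ v = z.
  by apply/conjg_fixP/commgP; case/setIP: Zz => _ /centP; apply.
have cyz : commute y z := centsP cEab y Ey z Ez.
pose w := v * u ^+ k * v.
have yw : y ^ w = z.
  by rewrite /w !conjgM yv (conjMg y z) zuk yuk mulgA cyz mulgK cvz.
have zw : z ^ w = y^-1.
  by rewrite /w !conjgM cvz zuk (conjMg z) conjVg yv cvz invMg mulKVg.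
have zw2 : z ^ (w * w) = z^-1 by rewrite conjgM zw conjVg yw.
have Pw2 : w * w \in P.
  rewrite (subsetP sNZ) // !inE !groupM ?groupX //=.
  by rewrite genZ -cycleJ zw2 cycleV.
have /eqP : z ^ (w * w) = z.
  by apply/conjg_fixP/commgP; case/setIP: Zz => _ /centP; apply.
rewrite zw2 eq_invg_mul -[_ * _]/(z ^+ 2) -order_dvdn => o2.
have /eqP : #[z] == p by rewrite /order -genZ oZ.
move=> oz; move: o2; rewrite oz dvdn_prime2 // => /eqP p2.
by rewrite p2 in odd_p.
Qed.

(** By [pelt_norm_selfcent_p2], a centralizer of order [p ^ 2] in [P] is Sylow in the full
    centralizer. So [g] can be corrected by an element centralizing [t ^ g] to carry ['C_P[t]] onto
    ['C_P[t ^ g]], and the corrected element must lie in [P]. *)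
Lemma p2_cent1_control_fusion (gT : finGroupType) (p : nat) (G P : {group gT})
    (t g : gT) :
    prime p -> odd p -> p.-Sylow(G) P -> ~~ abelian P -> #|'Z(P)| = p ->
    'N_G('Z(P)) \subset P -> t \in P -> #|'C_P[t]| = (p ^ 2)%N ->
    g \in G -> t ^ g \in P ->
  exists2 y, y \in P & t ^ g = t ^ y.
Proof.
move=> p_pr odd_p sylP nabP oZ sNZ Pt oCt Gg Ps; set s := t ^ g.
have [sPG pP _] := and3P sylP.
have Gt := subsetP sPG t Pt.
have ZsubC x : x \in P -> 'Z(P) \subset 'C_P[x].
  move=> Px; rewrite subsetI center_sub sub_cent1 (subsetP _ x Px) //.
  by rewrite centsC subsetIr.
have selfC x : x \in P -> #|'C_P[x]| = (p ^ 2)%N ->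
  [/\ 'C_P('C_P[x]) = 'C_P[x], 'C_P[x] \proper P & p.-Sylow('C_G[x]) 'C_P[x]].
  move=> Px oCx; have cCC: abelian 'C_P[x] by apply: card_p2group_abelian oCx.
  have Cx : x \in 'C_P[x] by rewrite inE Px cent1id.
  have cCE: 'C_P('C_P[x]) = 'C_P[x].
    apply/eqP; rewrite eqEsubset setIS; last first.
      by apply/subsetP=> y /centP cy; apply/cent1P; rewrite /commute cy.
    by rewrite subsetI subsetIl.
  have ltCP: 'C_P[x] \proper P.
    rewrite properEneq subsetIl andbT; apply: contra nabP => /eqP <-.
    exact: cCC.
  split=> //.
  have sCC : 'C_P[x] \subset 'C_G[x] by rewrite setSI.
  have pC := pgroupS (subsetIl P 'C[x]) pP.
  have [Q sylQ sCQ] := Sylow_superset sCC pC.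
  have [sQC pQ _] := and3P sylQ.
  (* Normalizers grow in the p-group [Q], so it is enough that ['C_P[x]] is its own normalizer
     there. *)
  suffices <- : Q :=: 'C_P[x] by [].
  apply: (nilpotent_sub_norm (pgroup_nil pQ) sCQ).
  apply/subsetP=> u /setIP[Qu nCu].
  have /setIP[Gu cxu] := subsetP sQC u Qu.
  rewrite inE cxu andbT.
  exact: (pelt_norm_selfcent_p2 p_pr odd_p pP sPG oZ sNZ ltCP cCE oCx Gu
    (mem_p_elt pQ Qu) nCu).
have [cCt ltCtP sylCt] := selfC t Pt oCt.
have CJ : 'C_G[t] :^ g = 'C_G[s].
  by rewrite conjIg conjGid // /s cent1J.
have sylCg : p.-Sylow('C_G[s]) ('C_P[t] :^ g) by rewrite -CJ pHallJ2.
have oCGs : (#|'C_G[s]|`_p = p ^ 2)%N.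
  by rewrite -(card_Hall sylCg) cardJg.
have sCs : 'C_P[s] \subset 'C_G[s] by rewrite setSI.
(* The order divides [p ^ 2] because ['C_G[s]] is conjugate to ['C_G[t]], and it exceeds [p] because
   [s] is not central: otherwise [#|P|] would divide [p ^ 2]. *)
have oCs : #|'C_P[s]| = (p ^ 2)%N.
  have notZs : s \notin 'Z(P).
    apply: contra nabP => /setIP[_ cPs].
    have dvP : #|P| %| p ^ 2.
      rewrite -oCGs -(part_pnat_id pP) partn_dvd // cardSg // subsetI sPG.
      by rewrite sub_cent1.
    apply: (p2group_abelian pP); rewrite -[leqRHS](pfactorK 2 p_pr).
    by rewrite dvdn_leq_log // expn_gt0 prime_gt0.
  have sZC := ZsubC s Ps.
  have : #|'C_P[s]| %| p ^ 2.
    have pCs := pgroupS (subsetIl P 'C[s]) pP.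
    by rewrite -oCGs -(part_pnat_id pCs) partn_dvd // cardSg.
  case/(dvdn_pfactor _ _ p_pr) => k le_k2 oC.
  have : 'Z(P) \proper 'C_P[s].
    rewrite properE sZC; apply: contra notZs => /subsetP-> //.
    by rewrite inE Ps cent1id.
  move/proper_card; rewrite oZ oC -[ltnLHS](expn1 p).
  rewrite ltn_exp2l ?(prime_gt1 p_pr) // => lt1k.
  by congr (p ^ _)%N; apply/eqP; rewrite eqn_leq le_k2.
have [cCs ltCsP sylCs] := selfC s Ps oCs.
have [c /setIP[Gc csc] defCs] := Sylow_trans sylCg sylCs.
(* h moves t to s and 'C_P[t] to 'C_P[s]; if it does not normalize 'Z(P), then
   'C_P[s] is generated by 'Z(P) and its conjugate, both centralized by u ^ h
   for u in 'N_P('C_P[t]). *)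
pose h := g * c.
have th : t ^ h = s.
  by rewrite conjgM; apply/conjg_fixP/commgP; rewrite /commute (cent1P csc).
have Gh : h \in G by rewrite groupM.
rewrite -conjsgM -/h in defCs.
have [Ph | notPh] := boolP (h \in P); first by exists h.
have [u /setIP[Pu nCu] notCu] :
  exists2 u, u \in 'N_P('C_P[t]) & u \notin 'C_P[t].
  have := nilpotent_proper_norm (pgroup_nil pP) ltCtP.
  by case/properP=> _ [u]; exists u.
have Puh : u ^ h \in P.
  apply: (pelt_norm_selfcent_p2 p_pr odd_p pP sPG oZ sNZ ltCsP cCs oCs).
  - by rewrite groupJ // (subsetP sPG).
  - by rewrite p_eltJ (mem_p_elt pP).
  by rewrite [in 'N(_)]defCs normJ memJ_conjg.
have sZh : 'Z(P) :^ h \subset 'C_P[s] by rewrite defCs conjSg ZsubC.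
have Zh_neq : 'Z(P) :^ h != 'Z(P).
  apply: contra notPh => /eqP Zh; rewrite (subsetP sNZ) // inE Gh.
  exact/normP.
have TIZ : 'Z(P) :&: 'Z(P) :^ h = 1.
  apply: prime_TIg; first by rewrite oZ.
  apply: contra Zh_neq => sZZ.
  by rewrite eq_sym eqEcard sZZ cardJg leqnn.
have defC : 'Z(P) * 'Z(P) :^ h = 'C_P[s].
  apply/eqP; rewrite eqEcard mul_subG ?ZsubC //= TI_cardMg // cardJg oZ oCs.
  by rewrite mulnn.
case/negP: notCu; rewrite -(memJ_conjg _ h).
have : u ^ h \in 'C_P('C_P[s]).
  rewrite inE Puh -defC centM inE (subsetP _ _ Puh) ?(centsC P) ?subsetIr //=.
  by rewrite centJ memJ_conjg (subsetP _ _ Pu) // centsC subsetIr.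
by rewrite cCs defCs.
Qed.

(** * Minimal counterexamples *)

(** The p'-core of [K] centralizes [T], so only the component of [g] in [T] acts. *)
Lemma nilpotent_Sylow_conj (gT : finGroupType) (p : nat) (K T : {group gT})
    (t g : gT) :
    nilpotent K -> p.-Sylow(K) T -> t \in T -> g \in K ->
  exists2 y, y \in T & t ^ g = t ^ y.
Proof.
move=> nilK sylT; have /dprodP[_ defK cOO _] := nilpotent_pcoreC p nilK.
rewrite (nilpotent_Hall_pcore nilK sylT) -{2}defK => Tt /mulsgP[a b Oa Ob ->].
exists a => //; rewrite conjgM; apply/conjg_fixP/commgP/commute_sym.
by apply: (centsP cOO) => //; rewrite groupJ.
Qed.

Lemma nil_pcore_neq1 (gT : finGroupType) (M : {group gT}) (r : nat) :
  nilpotent M -> prime r -> r %| #|M| -> 'O_r(M) != 1.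
Proof.
move=> nilM r_pr rM; rewrite trivg_card1.
rewrite (card_Hall (nilpotent_pcore_Hall r nilM)).
by rewrite p_part_eq1 mem_primes r_pr cardG_gt0 rM.
Qed.

Lemma maximal_proper_eq (gT : finGroupType) (G M D : {group gT}) :
  maximal M G -> M \subset D -> D \proper G -> D :=: M.
Proof. by case/maxgroupP=> _ maxM sMD ltDG; apply: maxM. Qed.

Section MinimalCounterexample.

Variables (gT : finGroupType) (G N : {group gT}).

Hypothesis hmax : forall M : {group gT}, maximal M G ->
  nilpotent M \/
  (exists p : nat, prime p /\ (#|G : M| = p \/ #|G : M| = (p ^ 2)%N)).
Hypotheses (nsNG : N <| G) (ntN : N :!=: 1) (perfN : N^`(1) = N).
Hypothesis minN : forall K : {group gT}, K <| G -> K :!=: 1 -> N \subset K.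

Implicit Types (D K L M P R T : {group gT}).

Lemma perfect_not_solvable : ~~ solvable N.
Proof.
apply/negP=> solN; have := sol_der1_proper solN (subxx N) ntN.
by rewrite perfN properxx.
Qed.

Lemma sol_normal_eq1 K : K <| G -> solvable K -> K :=: 1.
Proof.
move=> nsKG solK; apply/eqP; apply: contraNT perfect_not_solvable => ntK.
exact: solvableS (minN nsKG ntK) solK.
Qed.

Lemma norm_sol_proper D :
  D \subset G -> solvable D -> D :!=: 1 -> 'N_G(D) \proper G.
Proof.
move=> sDG solD; rewrite properE subsetIl; apply: contra => sGN.
rewrite (sol_normal_eq1 _ solD) // /normal sDG.
exact: subset_trans sGN (subsetIr _ _).
Qed.

Lemma nil_not_subset M : nilpotent M -> ~~ (N \subset M).
Proof.
move=> nilM; apply: contra perfect_not_solvable => sNM.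
exact: solvableS sNM (nilpotent_sol nilM).
Qed.

(** * Maximal subgroups not containing [N] *)

Lemma supplement_maximal M : maximal M G -> ~~ (N \subset M) -> N * M = G.
Proof.
move=> maxM not_sNM; have /maxgroupP[/andP[sMG _] _] := maxM.
have [sNG nNG] := andP nsNG; have nNM := subset_trans sMG nNG.
have sJG : N <*> M \subset G by rewrite join_subG sNG.
rewrite -norm_joinEr //; apply/eqP; rewrite eqEproper sJG.
apply: contra not_sNM => /(maximal_proper_eq maxM (joing_subr _ _)) <-.
exact: joing_subl.
Qed.

Lemma index_supplement_maximal M :
  maximal M G -> ~~ (N \subset M) -> #|G : M| = #|N : M|.
Proof.
move=> maxM not_sNM; have /maxgroupP[/andP[sMG _] _] := maxM.
apply/eqP; rewrite -(eqn_pmul2r (cardG_gt0 M)) (LagrangeMr N M).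
by rewrite (supplement_maximal maxM not_sNM) mulnC Lagrange.
Qed.

(** Every conjugate of [L] is a conjugate by an element of [P], so [K] lies in the core of [L]; a
    nontrivial core would contain [N]. *)
Lemma core_maximal_eq1 L P K :
    maximal L G -> ~~ (N \subset L) -> L * P = G -> P \subset 'N(K) ->
  K \subset L -> K :=: 1.
Proof.
move=> maxL not_sNL defG nKP sKL; have /maxgroupP[/andP[sLG _] _] := maxL.
have sKcore : K \subset gcore L G.
  apply/bigcapsP=> x; rewrite -defG => /mulsgP[y z Ly Pz ->].
  by rewrite conjsgM (conjGid Ly) -(normsP nKP z Pz) conjSg.
apply/trivgP; apply: subset_trans sKcore _.
apply: contraR not_sNL => ntC.
apply: subset_trans (gcore_sub L G).
by apply: (minN (gcore_normal sLG)); rewrite -subG1.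
Qed.

Lemma norm_nil_maximal M D :
  maximal M G -> nilpotent M -> D <| M -> D :!=: 1 -> 'N_G(D) = M.
Proof.
move=> maxM nilM /andP[sDM nDM] ntD; have /maxgroupP[/andP[sMG _] _] := maxM.
apply: (maximal_proper_eq maxM); first by rewrite subsetI sMG.
apply: norm_sol_proper ntD; first exact: subset_trans sDM sMG.
exact: solvableS sDM (nilpotent_sol nilM).
Qed.

(** A subgroup that is Sylow in its own normalizer, here [M], is Sylow in [G]. *)
Lemma pcore_nil_maximal_Sylow M (r : nat) :
  maximal M G -> nilpotent M -> 'O_r(M) != 1 -> r.-Sylow(G) 'O_r(M).
Proof.
move=> maxM nilM ntO; rewrite -Sylow_subnorm.
rewrite (norm_nil_maximal maxM nilM (pcore_normal _ _) ntO).
exact: nilpotent_pcore_Hall.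
Qed.

(** By the Frattini argument [N * 'N_G(R) = G], so a proper subgroup containing ['N_G(R)] cannot
    contain [N]. *)
Lemma Sylow_norm_maximal r R :
    r.-Sylow(N) R -> R :!=: 1 ->
  exists M, [/\ maximal M G, 'N_G(R) \subset M & ~~ (N \subset M)].
Proof.
move=> sylR ntR; have [sRN rR _] := and3P sylR; have [sNG nNG] := andP nsNG.
have sRG := subset_trans sRN sNG.
have ltNG := norm_sol_proper sRG (pgroup_sol rR) ntR.
have [eqNG | [M maxM sNM]] := maximal_exists (proper_sub ltNG).
  by rewrite eqNG properxx in ltNG.
exists M; split=> //; apply/negP=> sNM'.
have /maxgroupP[/andP[_ /negP not_sGM] _] := maxM; case: not_sGM.
by rewrite -(Frattini_arg nsNG sylR) mul_subG.
Qed.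

(** * The largest prime divisor of [#|N|] and its Sylow subgroup *)

Variables (p : nat) (T : {group gT}).
Hypotheses (p_pr : prime p) (p_gt3 : 3 < p).
Hypotheses (sylT : p.-Sylow(N) T) (ntT : T :!=: 1).
Hypothesis max_p : forall q, prime q -> q %| #|N| -> q <= p.

Let odd_p : odd p.
Proof. by case: (even_prime p_pr) p_gt3 => [->|]. Qed.

(** Sylow counting in [N] and in [N :&: M] gives [#|G : M|] congruent to 1 modulo [p]. For an index
    [q] or [q ^ 2] with [q <= p] prime this leaves only [p = q + 1], hence [p = 3]. *)
Lemma Sylow_norm_maximal_nil M :
  maximal M G -> ~~ (N \subset M) -> 'N_G(T) \subset M -> nilpotent M.
Proof.
move=> maxM not_sNM sNM; have [//|[q [q_pr oGM]]] := hmax maxM; exfalso.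
have [sTN _ _] := and3P sylT; have [sNG _] := andP nsNG.
have sNT : 'N_N(T) \subset M by apply: subset_trans sNM; rewrite setSI.
have sTM : T \subset M by rewrite (subset_trans _ sNT) // subsetI sTN normG.
have index1 : #|G : M| = 1 %[mod p].
  have sylTM : p.-Sylow(N :&: M) T.
    by apply: pHall_subl sylT; rewrite ?subsetIl // subsetI sTN.
  have sNNM : 'N_N(T) \subset N :&: M by rewrite subsetI subsetIl.
  have eqNN : 'N_(N :&: M)(T) = 'N_N(T).
    by apply/eqP; rewrite eqEsubset setSI ?subsetIl // subsetI sNNM subsetIr.
  have := card_Syl_mod N p_pr; have := card_Syl_mod (N :&: M) p_pr.
  rewrite (card_Syl sylT) (card_Syl sylTM) eqNN => iM1.
  rewrite -(Lagrange_index (subsetIl N M) sNNM) -modnMmr iM1 muln1 => iN1.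
  rewrite (index_supplement_maximal maxM not_sNM) -indexgI iN1.
  by rewrite modn_small ?prime_gt1.
have dvGM : #|G : M| %| #|N|.
  by rewrite (index_supplement_maximal maxM not_sNM) dvdn_indexg.
have q_gt1 := prime_gt1 q_pr.
have le_qp : q <= p.
  apply: max_p => //; apply: dvdn_trans dvGM.
  by case: oGM => ->; rewrite ?dvdn_exp.
have ltqp : q < p.
  rewrite ltn_neqAle le_qp andbT; apply: contraTneq p_pr => eqp.
  have: p %| #|G : M| by rewrite -eqp; case: oGM => ->; rewrite ?dvdn_exp.
  by rewrite /dvdn index1 modn_small ?prime_gt1.
case: oGM => oGM; rewrite oGM in index1.
  rewrite !modn_small ?(prime_gt1 p_pr) // in index1.
  by rewrite index1 in q_gt1.
have: p %| (q - 1) * (q + 1).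
  rewrite -subn_sqr -(eqn_mod_dvd p) ?exp1n ?index1 //.
  by rewrite -(exp1n 2) leq_exp2r // ltnW.
rewrite Euclid_dvdM // gtnNdvd ?subn_gt0 //=; last first.
  by apply: leq_ltn_trans ltqp; apply: leq_subr.
rewrite addn1 => /dvdn_leq => /(_ isT) le_pq.
have eq_pq : p = q.+1 by apply/eqP; rewrite eqn_leq le_pq.
have := odd_p; rewrite eq_pq /= => even_q.
case: (even_prime q_pr) => [q2|odd_q]; last by rewrite odd_q in even_q.
by have := p_gt3; rewrite eq_pq q2.
Qed.

Lemma Sylow_maximal :
  exists M, [/\ maximal M G, nilpotent M, 'N_G(T) = M & T \subset 'O_p(M)].
Proof.
have [M [maxM sNM not_sNM]] := Sylow_norm_maximal sylT ntT.
have nilM := Sylow_norm_maximal_nil maxM not_sNM sNM.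
have /maxgroupP[/andP[sMG _] _] := maxM.
have [sTN pT _] := and3P sylT.
have sTM : T \subset M.
  rewrite (subset_trans _ sNM) // subsetI normG.
  by rewrite (subset_trans sTN) ?normal_sub.
have sTO : T \subset 'O_p(M).
  by rewrite (sub_Hall_pcore (nilpotent_pcore_Hall p nilM)).
(* This makes [T] normal in [M], so that [M] is its normalizer. *)
have defT : T :=: 'O_p(M) :&: N.
  apply/esym/(sub_pHall sylT); rewrite ?subsetIr ?subsetI ?sTO //.
  by rewrite (pgroupS (subsetIl _ _)) ?pcore_pgroup.
exists M; split=> //; apply: (norm_nil_maximal maxM nilM _ ntT).
rewrite /normal sTM defT normsI ?(normal_norm (pcore_normal p M)) //.
exact: subset_trans sMG (normal_norm nsNG).
Qed.

(** Burnside's fusion argument: if [T] were abelian, conjugacy in [T] would be controlled by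
    ['N_N(T)], which is nilpotent and so would centralize [T]; the focal subgroup would be
    trivial. *)
Lemma Sylow_not_abelian : ~~ abelian T.
Proof.
apply: contra ntT => cTT; rewrite -subG1.
have [M [maxM nilM defM sTO]] := Sylow_maximal.
have [sTN pT _] := and3P sylT.
apply: (perfect_focal_sub perfN sylT) => //; first exact: normal1.
  by apply/trivgP/derG1P.
move=> t g Tt Ng Ttg.
have Ntg : t ^ g \in N by apply: (subsetP sTN).
have sTC : T \subset 'C_N[t ^ g].
  by rewrite subsetI sTN sub_cent1 (subsetP cTT).
have sTgC : T :^ g \subset 'C_N[t ^ g].
  rewrite subsetI -{1}(conjGid Ng) conjSg sTN cent1J conjSg sub_cent1.
  exact: (subsetP cTT).
have sylC : p.-Sylow('C_N[t ^ g]) T.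
  by apply: pHall_subl sylT; rewrite ?subsetIl.
have sylCg : p.-Sylow('C_N[t ^ g]) (T :^ g).
  by apply: pHall_subl (_ : p.-Sylow(N) (T :^ g)); rewrite ?subsetIl ?pHallJ.
have [c /setIP[Nc cc] defT] := Sylow_trans sylCg sylC.
have Ngc : g * c \in 'N_N(T).
  by rewrite inE groupM //=; apply/normP; rewrite conjsgM -defT.
have ttg : t ^ g = t ^ (g * c).
  by rewrite conjgM; apply/esym/conjg_fixP/commgP/commute_sym/cent1P.
have nilNT : nilpotent 'N_N(T).
  by apply: nilpotentS nilM; rewrite -defM setSI ?normal_sub.
have sylNT : p.-Sylow('N_N(T)) T by rewrite Sylow_subnorm.
have [y Ty tgc] := nilpotent_Sylow_conj nilNT sylNT Tt Ngc.
rewrite commgEl ttg tgc -commgEl; apply/set1gP/eqP/commgP.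
exact: (centsP cTT).
Qed.


(* A p-group acting on fewer than p^2 points has orbits of length 1 or p, so its
   derived subgroup acts trivially. *)
Lemma supplement_maximal_index_ge L :
  maximal L G -> ~~ (N \subset L) -> p ^ 2 <= #|G : L|.
Proof.
move=> maxL not_sNL; rewrite leqNgt; apply: contra Sylow_not_abelian => ltGL.
have /maxgroupP[/andP[sLG _] _] := maxL.
have [sTN pT _] := and3P sylT; have sTG := subset_trans sTN (normal_sub nsNG).
suffices sTL x : x \in G -> T^`(1) \subset L :^ x.
  have sTC : T^`(1) \subset gcore L G by apply/bigcapsP.
  apply/derG1P/trivgP; apply: subset_trans sTC _.
  apply: contraR not_sNL => ntC; apply: subset_trans (gcore_sub L G).
  by apply: (minN (gcore_normal sLG)); rewrite -subG1.
move=> Gx; set K := (T :&: L :^ x)%G.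
have sKT : K \subset T := subsetIl _ _.
have iTK : #|T : K| < p ^ 2.
  apply: leq_ltn_trans ltGL; rewrite indexgI.
  rewrite -[leqRHS](indexJg _ _ x) (conjGid Gx).
  by rewrite subset_leq_card // imsetS.
have /(dvdn_pfactor _ _ p_pr) : #|T : K| %| p ^ logn p #|T|.
  by rewrite -(card_pgroup pT) dvdn_indexg.
case=> k _ oTK; move: iTK; rewrite oTK ltn_exp2l ?(prime_gt1 p_pr) // => lt_k2.
apply: (subset_trans _ (subsetIr T (L :^ x))).
case: k => [|[|//]] in oTK lt_k2.
  by rewrite [T :&: _](index1g sKT oTK) der_sub.
have maxK : maximal K T by rewrite p_index_maximal // oTK.
have nKT := p_maximal_normal pT maxK.
apply: der1_min; first exact: normal_norm.
by rewrite cyclic_abelian // prime_cyclic // card_quotient ?normal_norm // oTK.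
Qed.

Lemma supplement_maximal_index L :
    maximal L G -> ~~ (N \subset L) -> ~~ nilpotent L ->
  #|G : L| = (p ^ 2)%N.
Proof.
move=> maxL not_sNL nnilL.
have [/idPn//|[q [q_pr oGL]]] := hmax maxL.
have le_p2 := supplement_maximal_index_ge maxL not_sNL.
have dvGL : #|G : L| %| #|N|.
  by rewrite (index_supplement_maximal maxL not_sNL) dvdn_indexg.
have le_qp : q <= p.
  apply: max_p => //; apply: dvdn_trans dvGL.
  by case: oGL => ->; rewrite ?dvdn_exp.
case: oGL => oGL; rewrite oGL in le_p2 *.
  have: p ^ 2 <= p ^ 1 by rewrite expn1 (leq_trans le_p2).
  by rewrite leq_exp2l // prime_gt1.
by apply/eqP; rewrite eqn_leq le_p2 leq_exp2r // le_qp.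
Qed.

(** * The case where every maximal supplement is nilpotent *)

Lemma nil_maximal_index M (r : nat) :
    maximal M G -> nilpotent M -> prime r -> r %| #|M| ->
  ~~ (r %| #|G : M|) /\ r.-Sylow(G) 'O_r(M).
Proof.
move=> maxM nilM r_pr rM; have ntO := nil_pcore_neq1 nilM r_pr rM.
have sylG := pcore_nil_maximal_Sylow maxM nilM ntO; split=> //.
have /maxgroupP[/andP[sMG _] _] := maxM.
have [_ _ r'i] := and3P sylG; apply: contraL r'i => rGM.
apply/negP=> r'i; have := pnat_dvd (dvdn_trans rGM _) r'i.
rewrite -(Lagrange_index sMG (pcore_sub r M)) dvdn_mulr // => /(_ isT).
by rewrite pnatE // !inE eqxx.
Qed.

(** Each subgroup is recovered as the normalizer of its [r]-core, a Sylow subgroup of [G]. *)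
Lemma nil_maximal_conj M1 M2 (r : nat) :
    maximal M1 G -> nilpotent M1 -> maximal M2 G -> nilpotent M2 -> prime r ->
    r %| #|M1| -> r %| #|M2| ->
  exists2 x, x \in G & M2 :=: M1 :^ x.
Proof.
move=> maxM1 nilM1 maxM2 nilM2 r_pr rM1 rM2.
have [_ syl1] := nil_maximal_index maxM1 nilM1 r_pr rM1.
have [_ syl2] := nil_maximal_index maxM2 nilM2 r_pr rM2.
have [x Gx eqO] := Sylow_trans syl1 syl2; exists x => //.
have /maxgroupP[/andP[sM1G _] _] := maxM1.
have /maxgroupP[/andP[sM2G _] _] := maxM2.
rewrite -(norm_nil_maximal maxM2 nilM2 (pcore_normal r _)) ?nil_pcore_neq1 //.
rewrite -(norm_nil_maximal maxM1 nilM1 (pcore_normal r _)) ?nil_pcore_neq1 //.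
by rewrite eqO normJ conjIg conjGid.
Qed.

(* A prime r dividing #|G : N| divides the order of every supplement of N, so
   all the maximal ones are conjugate to 'N_G(T), which therefore contains Sylow
   subgroups of G for all primes. *)
Lemma all_supplements_nil_eq :
  (forall L, maximal L G -> ~~ (N \subset L) -> nilpotent L) -> G :=: N.
Proof.
move=> nil_max; apply/esym/(index1g (normal_sub nsNG)).
apply/eqP/idPn=> iGN_neq1; have [sNG nNG] := andP nsNG.
pose r := pdiv #|G : N|; have r_pr : prime r.
  by rewrite pdiv_prime // ltn_neqAle eq_sym iGN_neq1 indexg_gt0.
have rM M : maximal M G -> ~~ (N \subset M) -> r %| #|M|.
  move=> maxM not_sNM; apply: dvdn_trans (pdiv_dvd _) _.
  have /maxgroupP[/andP[sMG _] _] := maxM.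
  rewrite -card_quotient // -(supplement_maximal maxM not_sNM) quotientMidl.
  by rewrite dvdn_morphim.
have [M [maxM nilM _ _]] := Sylow_maximal.
have not_sNM := nil_not_subset nilM.
have [s_gt1 | ] := ltnP 1 #|G : M|; last first.
  rewrite leq_eqVlt ltnNge indexg_gt0 orbF => /eqP iGM.
  have /maxgroupP[ltMG _] := maxM.
  by have := ltMG; rewrite (index1g (proper_sub ltMG) iGM) properxx.
(* The prime [s] also divides the order of a conjugate of [M], against the Hall property of [M]. *)
pose s := pdiv #|G : M|; have s_pr : prime s by rewrite pdiv_prime.
have [S sylS] := Sylow_exists s N.
have ntS : S :!=: 1.
  rewrite trivg_card1 (card_Hall sylS) p_part_eq1 mem_primes s_pr cardG_gt0.
  rewrite (dvdn_trans (pdiv_dvd _)) //.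
  by rewrite (index_supplement_maximal maxM not_sNM) dvdn_indexg.
have [L [maxL sNL not_sNL]] := Sylow_norm_maximal sylS ntS.
have nilL := nil_max L maxL not_sNL.
have [sSN sS _] := and3P sylS.
have sL : s %| #|L|.
  have [_ sdvS _] := pgroup_pdiv sS ntS.
  rewrite (dvdn_trans sdvS) // cardSg // (subset_trans _ sNL) //.
  by rewrite subsetI normG (subset_trans sSN).
have [x Gx defL] := nil_maximal_conj maxM nilM maxL nilL r_pr
  (rM M maxM not_sNM) (rM L maxL not_sNL).
have [/negP not_dv _] := nil_maximal_index maxL nilL s_pr sL; case: not_dv.
by rewrite defL -{1}(conjGid Gx) indexJg pdiv_dvd.
Qed.

(** Induction towards larger intersections: a maximal [L] contains the normalizer of [M1 :&: M2]. As
    normalizers grow in nilpotent groups, each of [M1], [M2] meets [L] in a larger subgroup, unless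
    the intersection is the whole group, and so equals [L]. *)
Lemma nilpotent_maximal_TI M1 M2 :
    (forall L, maximal L G -> nilpotent L) -> maximal M1 G -> maximal M2 G ->
  M1 :&: M2 != 1 -> M1 :=: M2.
Proof.
move=> nil_max; have [n] := ubnP (#|G| - #|M1 :&: M2|).
elim: n M1 M2 => // n IHn M1 M2 /ltnSE-leGn maxM1 maxM2 ntD.
set D := (M1 :&: M2)%G in leGn ntD.
have solM L : maximal L G -> solvable L by move/nil_max/nilpotent_sol.
have ltMG L : maximal L G -> L \proper G by case/maxgroupP.
have sDM1 : D \subset M1 := subsetIl _ _.
have sDM2 : D \subset M2 := subsetIr _ _.
have sDG := subset_trans sDM1 (proper_sub (ltMG _ maxM1)).
have ltNG : 'N_G(D) \proper G.
  by apply: norm_sol_proper ntD => //; apply: solvableS sDM1 (solM _ maxM1).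
have [eqNG | [L maxL sNL]] := maximal_exists (proper_sub ltNG).
  by rewrite eqNG properxx in ltNG.
have eqML M M' : D :=: M :&: M' -> maximal M G -> maximal M' G ->
  M :=: L \/ M :=: M'.
  move=> defD maxM maxM'.
  have sDM : D \subset M by rewrite defD subsetIl.
  have [eqDM | ltDM] := eqVproper sDM.
    right; apply/esym/(maximal_proper_eq maxM); last exact: ltMG.
    by rewrite -eqDM defD subsetIr.
  have ltNML : D \proper M :&: L.
    apply: proper_sub_trans (nilpotent_proper_norm (nil_max _ maxM) ltDM) _.
    rewrite subsetI subsetIl (subset_trans _ sNL) // setSI //.
    by rewrite proper_sub ?ltMG.
  left; apply: IHn => //; last first.
    apply: contra (proper_subn ltNML) => /eqP->; exact: sub1G.
  apply: leq_trans leGn; rewrite ltn_sub2l ?proper_card //.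
  exact: sub_proper_trans sDM1 (ltMG _ maxM1).
have [eqM1L|//] := eqML M1 M2 erefl maxM1 maxM2.
have [eqM2L|//] := eqML M2 M1 (setIC _ _) maxM2 maxM1.
by rewrite eqM1L eqM2L.
Qed.

Lemma not_all_supplements_nil :
  ~ (forall L, maximal L G -> ~~ (N \subset L) -> nilpotent L).
Proof.
move=> nil_max; have defG := all_supplements_nil_eq nil_max.
have maxG_nil L : maximal L G -> nilpotent L.
  move=> maxL; apply: nil_max => //; case/maxgroupP: maxL => ltLG _.
  by rewrite -defG proper_subn.
have [M [maxM nilM defM sTO]] := Sylow_maximal.
have [sTN pT _] := and3P sylT.
have := sol_der1_proper (pgroup_sol pT) (subxx T) ntT.
rewrite properE der_sub => /negP[].
apply: (perfect_focal_sub perfN sylT) => //; first exact: der_normal.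
move=> t g Tt Ng Ttg.
have [-> | nt] := eqVneq t 1; first by rewrite comm1g group1.
have Gg : g \in G by rewrite defG.
have sTM : T \subset M := subset_trans sTO (pcore_sub _ _).
have ntM : M :!=: 1 by apply: contra ntT => /eqP M1; rewrite -subG1 -M1.
(* Both [M] and [M :^ g] contain [t ^ g], so they coincide, and [M] is its own normalizer. *)
have Mg : g \in M.
  rewrite -(norm_nil_maximal maxM nilM (normal_refl M) ntM) inE Gg.
  apply/normP/esym; apply: (nilpotent_maximal_TI maxG_nil maxM).
    by rewrite -(conjGid Gg) maximalJ.
  apply: contra nt => /eqP/trivgP/subsetP MM1.
  rewrite -(conjg_eq1 t g) -in_set1 MM1 // inE memJ_conjg !(subsetP sTM) //.
have sylNT : p.-Sylow('N_G(T)) T.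
  by rewrite Sylow_subnorm defG.
rewrite -defM in Mg; rewrite -defM in nilM.
have [y Ty tgy] := nilpotent_Sylow_conj nilM sylNT Tt Mg.
by rewrite commgEl tgy -commgEl mem_commg.
Qed.

(** * A maximal supplement of index [p ^ 2] *)

Lemma index_p2_maximal_pgroup L :
    maximal L G -> ~~ (N \subset L) -> #|G : L| = (p ^ 2)%N ->
  exists P, [/\ p.-Sylow(G) P, maximal P G, T \subset P & L * P = G].
Proof.
move=> maxL not_sNL oGL; have [M [maxM nilM defM sTO]] := Sylow_maximal.
have ntO : 'O_p(M) != 1 by apply: contra ntT => /eqP O1; rewrite -subG1 -O1.
have sylP := pcore_nil_maximal_Sylow maxM nilM ntO.
have /maxgroupP[/andP[sLG _] _] := maxL.
have /maxgroupP[/andP[sMG _] _] := maxM.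
have sPM := pcore_sub p M.
have co_iLP : coprime #|G : L| #|G : 'O_p(M)|.
  have [_ _ p'i] := and3P sylP; rewrite oGL.
  by apply: pnat_coprime p'i; rewrite pnatX pnat_id.
have defLP : L * 'O_p(M) = G := coprime_index_mulG sLG (pHall_sub sylP) co_iLP.
have defML : M * L = G.
  apply/eqP; rewrite eqEsubset mul_subG //=.
  rewrite -{1}(coprime_index_mulG (pHall_sub sylP) sLG) 1?coprime_sym //.
  exact: mulSg.
have oML : #|M : M :&: L| = (p ^ 2)%N.
  rewrite indexgI -oGL; apply/eqP.
  by rewrite -(eqn_pmul2r (cardG_gt0 L)) (LagrangeMr M L) defML mulnC Lagrange.
(* Since [M :&: L] has index a power of [p] in [M], it contains the whole p'-core of [M]. Being
   normalized by ['O_p(M)], this core is then trivial. *)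
have sQL : 'O_p^'(M) \subset L.
  have nilK : nilpotent (M :&: L) := nilpotentS (subsetIl _ _) nilM.
  have sylK := nilpotent_pcore_Hall p^' nilK.
  have sylQ := nilpotent_pcore_Hall p^' nilM.
  have sKQ : 'O_p^'(M :&: L) \subset 'O_p^'(M).
    rewrite (sub_Hall_pcore sylQ) ?pcore_pgroup //.
    exact: subset_trans (pcore_sub _ _) (subsetIl _ _).
  have <- : 'O_p^'(M :&: L) = 'O_p^'(M).
    apply/eqP; rewrite eqEcard sKQ (card_Hall sylK) (card_Hall sylQ).
    rewrite -(Lagrange (subsetIl M L)) oML.
    rewrite partnM ?cardG_gt0 ?expn_gt0 ?prime_gt0 //.
    rewrite (@part_p'nat p^' (p ^ 2)) ?muln1 ?leqnn //.
    by rewrite pnatNK pnatX pnat_id.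
  exact: subset_trans (pcore_sub _ _) (subsetIr _ _).
have Q1 : 'O_p^'(M) = 1.
  apply: (core_maximal_eq1 maxL not_sNL defLP _ sQL).
  exact: (subset_trans sPM (normal_norm (pcore_normal p^' M))).
have defP : M :=: 'O_p(M).
  have /dprodP[_ defPQ _ _] := nilpotent_pcoreC p nilM.
  by rewrite -{1}defPQ Q1 mulg1.
by exists 'O_p(M)%G; split=> //; rewrite (_ : 'O_p(M)%G = M) //; apply: val_inj.
Qed.

(** Subgroups of [L] normalized by [P] are trivial. For [A] between [S = P :&: L] and [P], with [S]
    of index [p] in [A], this applies to the derived subgroup of [A]. It also applies to
    ['Z(P) :&: L], so ['Z(P) * S] inside [A] bounds the centre by [p]. *)
Lemma index_p2_abelian_maximal L P :
    maximal L G -> ~~ (N \subset L) -> #|G : L| = (p ^ 2)%N ->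
    p.-Sylow(G) P -> L * P = G -> ~~ abelian P ->
  exists A : {group gT},
    [/\ maximal A P, abelian A, #|'Z(P)| = p & 'Z(P) \subset A].
Proof.
move=> maxL not_sNL oGL sylP defG nabP; have [sPG pP _] := and3P sylP.
have /maxgroupP[/andP[sLG _] _] := maxL.
pose S := (P :&: L)%G.
have oPS : #|P : S| = (p ^ 2)%N.
  rewrite indexgI -oGL; apply/eqP.
  by rewrite -(eqn_pmul2l (cardG_gt0 L)) (LagrangeMl L P) defG Lagrange.
have sSP : S \subset P := subsetIl _ _.
have [eqSP | [A maxA sSA]] := maximal_exists sSP.
  move: oPS; rewrite eqSP indexgg => /eqP; rewrite -(exp1n 2) eqn_exp2r //.
  by rewrite eq_sym => /eqP p1; have := p_gt3; rewrite p1.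
have nsAP := p_maximal_normal pP maxA; have [sAP nAP] := andP nsAP.
have pA := pgroupS sAP pP.
have oPA := p_maximal_index pP maxA.
have oAS : #|A : S| = p.
  apply/eqP; rewrite -(eqn_pmul2l (prime_gt0 p_pr)) -{1}oPA Lagrange_index //.
  by rewrite oPS mulnn.
have nsSA : S <| A.
  by apply: (p_maximal_normal pA); rewrite p_index_maximal ?oAS.
have cAA : abelian A.
  apply/derG1P; apply: (core_maximal_eq1 maxL not_sNL defG).
    exact: gFnorm_trans.
  apply: (subset_trans _ (subsetIr P L)); apply: der1_min.
    exact: normal_norm.
  rewrite cyclic_abelian // prime_cyclic //.
  by rewrite card_quotient ?normal_norm // oAS.
have sZA : 'Z(P) \subset A.
  apply: contraR nabP => not_sZA.
  rewrite -(mulg_normal_maximal nsAP maxA (center_sub P) not_sZA).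
  rewrite abelianM cAA center_abelian /=.
  exact: subset_trans (subsetIr _ _) (centS sAP).
exists A; split=> //.
have Z_S1 : 'Z(P) :&: S = 1.
  have ZL1 : 'Z(P) :&: L = 1.
    apply: (core_maximal_eq1 maxL not_sNL defG (K := ('Z(P) :&: L)%G)).
      by rewrite cents_norm // centsC subIset // subsetIr.
    exact: subsetIr.
  by apply/trivgP; rewrite -ZL1 setIS ?subsetIr.
have ntZ : 'Z(P) != 1.
  by apply: contra nabP => /eqP/(trivg_center_pgroup pP)->; apply: abelian1.
have [_ p_dv_Z _] := pgroup_pdiv (pgroupS (center_sub P) pP) ntZ.
apply/eqP; rewrite eqn_leq (dvdn_leq _ p_dv_Z) ?cardG_gt0 // andbT.
rewrite -(leq_pmul2r (cardG_gt0 S)) -TI_cardMg //.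
by rewrite -oAS mulnC Lagrange // subset_leq_card // mul_subG.
Qed.

Lemma maximal_index_neq_p2 L :
  maximal L G -> ~~ (N \subset L) -> #|G : L| <> (p ^ 2)%N.
Proof.
move=> maxL not_sNL oGL.
have [P [sylP maxP sTP defG]] := index_p2_maximal_pgroup maxL not_sNL oGL.
have nabP : ~~ abelian P by apply: contra Sylow_not_abelian; apply: abelianS.
have [A [maxA cAA oZ sZA]] :=
  index_p2_abelian_maximal maxL not_sNL oGL sylP defG nabP.
have [sPG pP _] := and3P sylP; have [sTN pT _] := and3P sylT.
have nsAP := p_maximal_normal pP maxA; have [sAP nAP] := andP nsAP.
have oPA := p_maximal_index pP maxA.
have ntZ : 'Z(P) != 1 by rewrite trivg_card1 oZ neq_ltn prime_gt1 ?orbT.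
have sNZ : 'N_G('Z(P)) \subset P.
  by rewrite (norm_nil_maximal maxP (pgroup_nil pP) (center_normal P) ntZ).
have sP'A : P^`(1) \subset A.
  apply: der1_min => //.
  by rewrite cyclic_abelian // prime_cyclic // card_quotient // oPA.
(* An element of the abelian group [A] commuting with [t] centralizes [A * <[t]> = P]. So ['C_P[t]]
   meets [A] in ['Z(P)], and the product formula gives [p ^ 2]. *)
have oC t : t \in P -> t \notin A -> #|'C_P[t]| = (p ^ 2)%N.
  move=> Pt notAt.
  have defCA : A :&: 'C_P[t] = 'Z(P).
    apply/eqP; rewrite eqEsubset; apply/andP; split; last first.
      rewrite subsetI sZA subsetI center_sub sub_cent1 (subsetP _ t Pt) //.
      by rewrite centsC subsetIr.
    apply/subsetP=> x /setIP[Ax /setIP[Px ctx]]; apply/setIP; split=> //.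
    have sTP' : <[t]> \subset P by rewrite cycle_subG.
    have not_sTA : ~~ (<[t]> \subset A) by rewrite cycle_subG.
    rewrite -(mulg_normal_maximal nsAP maxA sTP' not_sTA) centM inE.
    by rewrite (subsetP cAA) //= cent_cycle.
  have not_sCA : ~~ ('C_P[t] \subset A).
    by apply: contra notAt => /subsetP-> //; rewrite inE Pt cent1id.
  have := mul_cardG A [group of 'C_P[t]].
  rewrite /= (mulg_normal_maximal nsAP maxA (subsetIl _ _) not_sCA) defCA oZ.
  rewrite -(Lagrange sAP) oPA -mulnA mulnn => /eqP.
  by rewrite eqn_pmul2l ?cardG_gt0 // => /eqP.
have fusion t g : t \in P -> t \notin A -> g \in G -> t ^ g \in P ->
  exists2 y, y \in P & t ^ g = t ^ y.
  move=> Pt notAt Gg Ptg.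
  exact: p2_cent1_control_fusion p_pr odd_p sylP nabP oZ sNZ Pt
    (oC t Pt notAt) Gg Ptg.
have memAJ t y : y \in P -> (t ^ y \in A) = (t \in A).
  by move=> Py; rewrite memJ_norm // (subsetP nAP).
case/negP: Sylow_not_abelian; apply: abelianS cAA.
apply: subset_trans (subsetIr T A).
apply: (perfect_focal_sub (B := (T :&: A)%G) perfN sylT).
    exact: (normalGI sTP nsAP).
  by rewrite subsetI der_sub (subset_trans _ sP'A) ?dergS.
move=> t g Tt Ng Ttg; have Gg := subsetP (normal_sub nsNG) g Ng.
have [Pt Ptg] := (subsetP sTP t Tt, subsetP sTP _ Ttg).
rewrite inE {1}commgEl groupM ?groupV //=.
(* Outside [A], [g] may be replaced by an element of [P], and the commutator lies in the derived
   subgroup of [P]. Inside [A], [t ^ g] stays in [A], by fusion applied to [t ^ g] and [g^-1]. *)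
have [At | notAt] := boolP (t \in A); last first.
  have [y Py tgy] := fusion t g Pt notAt Gg Ptg.
  by rewrite commgEl tgy -commgEl (subsetP sP'A) ?mem_commg.
rewrite commgEl groupM ?groupV //; apply: contraLR At => notAtg.
have [||y Py] := fusion _ g^-1 Ptg notAtg; rewrite ?groupV ?conjgK //.
by move->; rewrite memAJ.
Qed.

End MinimalCounterexample.

(** * Choice of the prime and reduction to a unique minimal normal subgroup *)

Lemma perfect_unique_minimal_normal_absurd (gT : finGroupType)
    (G N : {group gT}) :
    (forall M : {group gT}, maximal M G ->
      nilpotent M \/
      (exists p : nat, prime p /\ (#|G : M| = p \/ #|G : M| = (p ^ 2)%N))) ->
    N <| G -> N :!=: 1 -> N^`(1) = N ->
    (forall K : {group gT}, K <| G -> K :!=: 1 -> N \subset K) ->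
  False.
Proof.
move=> hmax nsNG ntN perfN minN.
pose p := max_pdiv #|N|; have N_gt1 : 1 < #|N| by rewrite cardG_gt1.
have p_pr : prime p by apply: max_pdiv_prime.
have max_p q : prime q -> q %| #|N| -> q <= p.
  by move=> q_pr qN; apply: max_pdiv_max; rewrite mem_primes q_pr cardG_gt0.
have p_gt3 : 3 < p.
  rewrite ltnNge; apply: contra (perfect_not_solvable ntN perfN) => p_le3.
  apply: Burnside_p_a_q_b; apply: (@uniq_leq_size _ _ [:: 2; 3]).
    exact: primes_uniq.
  move=> q; rewrite mem_primes => /and3P[q_pr _ /(max_p q q_pr) le_qp].
  by have := leq_trans le_qp p_le3; case: q q_pr {le_qp} => [|[|[|[|]]]].
have [T sylT] := Sylow_exists p N.
have ntT : T :!=: 1.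
  rewrite trivg_card1 (card_Hall sylT) p_part_eq1 mem_primes p_pr cardG_gt0.
  by rewrite max_pdiv_dvd.
apply: (not_all_supplements_nil hmax nsNG ntN perfN minN p_pr p_gt3 sylT ntT
  max_p).
move=> L maxL not_sNL; apply/idPn=> nnilL.
have := supplement_maximal_index hmax nsNG ntN perfN minN p_pr p_gt3 sylT ntT
  max_p maxL not_sNL nnilL.
exact: (maximal_index_neq_p2 hmax nsNG ntN perfN minN p_pr p_gt3 sylT ntT
  max_p).
Qed.

Theorem theoremA (gT : finGroupType) (G : {group gT})
  (hmax : forall M : {group gT}, maximal M G ->
     nilpotent M \/
     (exists p : nat, prime p /\ (#|G : M| = p \/ #|G : M| = (p ^ 2)%N))) :
  solvable G.
Proof.
(* The induction on the order also generalizes the group type, which changes in quotients. *)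
have [n] := ubnP #|G|; elim: n gT G hmax => // n IHn gT G hmax /ltnSE-leGn.
apply: contraT => nsolG.
have solq (K : {group gT}) : K <| G -> K :!=: 1 -> solvable (G / K).
  move=> nsKG ntK; apply: IHn; last first.
    exact: leq_trans (ltn_quotient ntK (normal_sub nsKG)) leGn.
  move=> Q maxQ; have /maxgroupP[/andP[sQG _] _] := maxQ.
  have [M defQ sKM sMG] := inv_quotientS nsKG sQG.
  have nsKM : K <| M := normalS sKM sMG nsKG.
  have maxM : maximal M G by rewrite -(quotient_maximal nsKM nsKG) -defQ.
  rewrite defQ index_quotient_eq ?normal_norm //
          ?(subset_trans (subsetIr _ _)) //.
  by have [nilM | iM] := hmax M maxM; [left; apply: quotient_nil | right].
have ntG : G :!=: 1 by apply: contraNneq nsolG => ->; apply: solvable1.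
have [N minNG sNG] := minnormal_exists ntG (normG G).
have [/andP[ntN nNG] minN] := mingroupP minNG.
have nsNG : N <| G by rewrite /normal sNG.
have nsolN : ~~ solvable N.
  by apply: contra nsolG => solN; rewrite (series_sol nsNG) solN solq.
case: (perfect_unique_minimal_normal_absurd hmax nsNG ntN) => [|K nsKG ntK].
  rewrite -[RHS](minN (N^`(1))%G _ (der_sub 1 N)) //.
  rewrite (gFnorm_trans _ nNG) andbT.
  by apply: contra nsolN => /eqP/derG1P/abelian_sol.
have [sKG nKG] := andP nsKG.
(* If [N] met [K] trivially, it would embed in the solvable quotient [G / K]. *)
have [NK1 | ntNK] := eqVneq (N :&: K) 1; last first.
  by rewrite -(minN (N :&: K)%G _ (subsetIl N K)) ?subsetIr ?ntNK //= normsI.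
case/negP: nsolN; have nKN := subset_trans sNG nKG.
rewrite (isog_sol (quotient_isog nKN _)) 1?setIC //.
exact: solvableS (quotientS K sNG) (solq K nsKG ntK).
Qed.
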